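(* Let $p>0$ and $m>0$. The zero-mass probability $P_r(0;p,m)$ in the ABM class is increasing in $r\ge 0$: for every integer $r\ge 0$, $P_r(0;p,m)<P_{r+1}(0;p,m)$.
   Context: For $p>0$ and an integer $r\ge 0$, the ABM class natural exponential family (NEF) is the NEF on $\{0,1,2,\dots\}$ with variance function $V_p(m)=m\left(1+\frac mp\right)^r$ on the mean domain $(0,\infty)$. (The variance function of an NEF gives the variance of each member as a function of its mean $m$; together with its domain it determines the NEF uniquely.) In its mean value parameterization, the member with mean $m$ has probability masses $(\mu_p^* )_n\exp\big(n\psi_p(m)-\phi_{p,r}(m)\big)$, $n=0,1,\dots$, where $\psi_p$ is a primitive of $1/V_p(m)$, $\phi_{p,r}$ is the primitive of $m/V_p(m)$ on $(0,\infty)$ with $\lim_{m\to0^+}\phi_{p,r}(m)=0$, and $\mu_p^*$ is a generating measure of the NEF with $(\mu_p^* )_0=1$. $P_r(0;p,m)$ denotes the mass at $0$ of the member with mean $m$, that is, $P_r(0;p,m)=\exp(-\phi_{p,r}(m))$. For $r=0$ (Poisson) this is $e^{-m}$. *)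

(* Defs.v *)
From Stdlib Require Import Reals.
From Coquelicot Require Import Coquelicot.

Open Scope R_scope.

(** Stdlib's [R] with Coquelicot.  Measures and distributions on {0, 1, 2, ...}
    are encoded by their mass functions [nat -> R], and a natural exponential
    family by the predicate selecting its members. *)

Definition laplace_summand (mu : nat -> R) (theta : R) (n : nat) : R :=
  mu n * exp (INR n * theta).

Definition laplace (mu : nat -> R) (theta : R) : R :=
  Series (laplace_summand mu theta).

(** The interior of the domain of convergence of the Laplace transform. *)
Definition canonical_domain (mu : nat -> R) (theta : R) : Prop :=
  locally theta (fun t => ex_series (laplace_summand mu t)).

Definition generating_measure (mu : nat -> R) : Prop :=
  (forall n, 0 <= mu n) /\
  (exists i j, i <> j /\ 0 < mu i /\ 0 < mu j) /\
  (exists theta, canonical_domain mu theta).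

Definition member_mass (mu : nat -> R) (theta : R) (n : nat) : R :=
  mu n * exp (INR n * theta) / laplace mu theta.

(** A family does not remember its generating measure: proportional or
    exponentially tilted measures generate the same family. *)
Definition is_nef (F : (nat -> R) -> Prop) : Prop :=
  exists mu : nat -> R, generating_measure mu /\
    forall P : nat -> R,
      F P <-> exists theta, canonical_domain mu theta /\
                            forall n, P n = member_mass mu theta n.

(** For members of a natural exponential family both series below converge,
    because the parameter is interior to the domain of convergence. *)
Definition mean (P : nat -> R) : R := Series (fun n => INR n * P n).

Definition variance (P : nat -> R) : R :=
  Series (fun n => (INR n - mean P) ^ 2 * P n).

Definition has_variance_function
    (F : (nat -> R) -> Prop) (M : R -> Prop) (V : R -> R) : Prop :=
  (forall m, M m <-> exists P, F P /\ mean P = m) /\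
  (forall P, F P -> variance P = V (mean P)).

Definition abm_variance (p : R) (r : nat) (m : R) : R := m * (1 + m / p) ^ r.

Definition is_abm_nef (p : R) (r : nat) (F : (nat -> R) -> Prop) : Prop :=
  is_nef F /\ has_variance_function F (fun m => 0 < m) (abm_variance p r).

(** [phi] is the primitive of [m / V m] on (0, +oo) with limit 0 at 0+; its
    values outside (0, +oo) are irrelevant. *)
Definition is_abm_phi (p : R) (r : nat) (phi : R -> R) : Prop :=
  (forall m, 0 < m -> is_derive phi m (m / abm_variance p r m)) /\
  filterlim phi (at_right 0) (locally 0).

(* Main.v *)
Require Import Defs.
From Stdlib Require Import Reals.
From Coquelicot Require Import Coquelicot.
From Stdlib Require Import Lra.

Open Scope R_scope.

(** Along a family with generating measure [mu], the zero mass
    [P_0 = mu_0 / L] and the mean [m = L' / L] satisfy [P_0' = - m P_0] and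
    [m' = V m], so [P_0 exp (phi m)] is constant in the canonical parameter.
    Since [1 - m <= P_0 <= 1], letting the mean tend to 0 shows that the constant
    is 1.  The comparison of [phi_r] and [phi_(r+1)] follows from that of their
    derivatives [(1 + x / p) ^ (- r)]. *)

(** * Laplace transforms as power series in [exp t] *)

Lemma is_derive_eq (f : R -> R) (x l l' : R) :
  is_derive f x l -> l = l' -> is_derive f x l'.
Proof. now intros H <-. Qed.

(** The Laplace transform of this sequence is the derivative of that of [mu], that is, the
    unnormalized first moment; iterating gives the second. *)
Definition degree_weighted (mu : nat -> R) (n : nat) : R := INR n * mu n.

Lemma exp_INR_mult (t : R) (n : nat) : exp (INR n * t) = exp t ^ n.
Proof.
  induction n as [|n IH].
  - simpl. rewrite Rmult_0_l. apply exp_0.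
  - rewrite S_INR, Rmult_plus_distr_r, exp_plus, IH, Rmult_1_l. simpl. ring.
Qed.

Lemma laplace_summand_pow (mu : nat -> R) (t : R) (n : nat) :
  laplace_summand mu t n = mu n * exp t ^ n.
Proof. unfold laplace_summand. now rewrite exp_INR_mult. Qed.

Lemma laplace_PSeries (mu : nat -> R) (t : R) :
  laplace mu t = PSeries mu (exp t).
Proof. apply Series_ext. intros n. apply laplace_summand_pow. Qed.

(** An interior parameter leaves room for convergence at some larger one, [t + d / 2]. The radius is
    then at least [exp (t + d / 2)], hence strictly above [exp t]. *)
Lemma canonical_domain_CV_radius (mu : nat -> R) (t : R) :
  canonical_domain mu t -> Rbar_lt (exp t) (CV_radius mu).
Proof.
  intros [d Hd].
  assert (He : ex_series (laplace_summand mu (t + d / 2))).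
  { apply Hd. pose proof (cond_pos d).
    change (Rabs (t + d / 2 - t) < d). rewrite Rabs_pos_eq; lra. }
  apply Rbar_lt_le_trans with (exp (t + d / 2)).
  - simpl. apply exp_increasing. pose proof (cond_pos d). lra.
  - apply Rbar_not_lt_le. intros H.
    apply (CV_disk_outside mu (exp (t + d / 2))).
    + rewrite Rabs_pos_eq by apply Rlt_le, exp_pos. exact H.
    + apply ex_series_lim_0.
      apply ex_series_ext with (2 := He). intros n. apply laplace_summand_pow.
Qed.

Lemma ex_series_laplace_summand (mu : nat -> R) (t : R) :
  Rbar_lt (exp t) (CV_radius mu) -> ex_series (laplace_summand mu t).
Proof.
  intros H.
  apply ex_series_ext with (fun n => mu n * exp t ^ n).
  - intros n. symmetry. apply laplace_summand_pow.
  - apply ex_pseries_R, CV_radius_inside.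
    rewrite Rabs_pos_eq by apply Rlt_le, exp_pos. exact H.
Qed.

(** Weighting by the degree is the operator [x d/dx] on power series. This gives both the unchanged
    radius of convergence and, at [x = exp t], the derivative in [t]. *)
Lemma degree_weighted_PS (mu : nat -> R) (n : nat) :
  degree_weighted mu n = PS_incr_1 (PS_derive mu) n.
Proof.
  destruct n as [|n]; unfold degree_weighted, PS_derive; simpl PS_incr_1.
  - simpl. rewrite Rmult_0_l. reflexivity.
  - reflexivity.
Qed.

Lemma CV_radius_degree_weighted (mu : nat -> R) :
  CV_radius (degree_weighted mu) = CV_radius mu.
Proof.
  rewrite (CV_radius_ext _ _ (degree_weighted_PS mu)).
  now rewrite CV_radius_incr_1, CV_radius_derive.
Qed.

Lemma is_derive_laplace (mu : nat -> R) (t : R) :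
  Rbar_lt (exp t) (CV_radius mu) ->
  is_derive (laplace mu) t (laplace (degree_weighted mu) t).
Proof.
  intros H.
  apply is_derive_ext with (fun s => PSeries mu (exp s)).
  { intros s. symmetry. apply laplace_PSeries. }
  rewrite laplace_PSeries, (PSeries_ext _ _ _ (degree_weighted_PS mu)).
  rewrite PSeries_incr_1.
  apply (is_derive_comp (PSeries mu) exp).
  - apply is_derive_PSeries. rewrite Rabs_pos_eq by apply Rlt_le, exp_pos. exact H.
  - apply is_derive_exp.
Qed.

Lemma is_series_laplace (mu : nat -> R) (t : R) :
  Rbar_lt (exp t) (CV_radius mu) ->
  is_series (laplace_summand mu t) (laplace mu t).
Proof. intros H. apply Series_correct, ex_series_laplace_summand, H. Qed.

(** A partial sum that reaches an index [i] with [0 < mu i] is already positive, and the remaining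
    terms are nonnegative. *)
Lemma laplace_pos (mu : nat -> R) (t : R) :
  generating_measure mu -> Rbar_lt (exp t) (CV_radius mu) -> 0 < laplace mu t.
Proof.
  intros (Hmu & (i & _ & _ & Hi & _) & _) H.
  assert (Hpos : forall n, 0 <= laplace_summand mu t n).
  { intros n. apply Rmult_le_pos; [apply Hmu | apply Rlt_le, exp_pos]. }
  pose proof (ex_series_laplace_summand mu t H) as He.
  apply Rlt_le_trans with (sum_f_R0 (laplace_summand mu t) i).
  - assert (Hi' : 0 < laplace_summand mu t i).
    { apply Rmult_lt_0_compat; [exact Hi | apply exp_pos]. }
    destruct i as [|i]; simpl; [exact Hi'|].
    pose proof (cond_pos_sum (laplace_summand mu t) i Hpos). lra.
  - apply sum_incr; [|exact Hpos].
    apply is_lim_seq_Reals.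
    apply is_lim_seq_ext with (sum_n (laplace_summand mu t)).
    + intros n. apply sum_n_Reals.
    + apply Series_correct, He.
Qed.

(** * Mean, variance and zero mass along the family *)

Lemma mean_member_mass (mu : nat -> R) (t : R) :
  mean (member_mass mu t) = laplace (degree_weighted mu) t / laplace mu t.
Proof.
  unfold Rdiv. unfold laplace at 1. rewrite <- Series_scal_r.
  apply Series_ext. intros n.
  unfold member_mass, laplace_summand, degree_weighted, Rdiv. ring.
Qed.

Lemma variance_member_mass (mu : nat -> R) (t : R) :
  Rbar_lt (exp t) (CV_radius mu) -> 0 < laplace mu t ->
  variance (member_mass mu t) =
    laplace (degree_weighted (degree_weighted mu)) t / laplace mu t
    - (laplace (degree_weighted mu) t / laplace mu t) ^ 2.
Proof.
  intros H Hpos. unfold variance. rewrite mean_member_mass.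
  set (A0 := laplace mu t) in *. set (A1 := laplace (degree_weighted mu) t).
  set (A2 := laplace (degree_weighted (degree_weighted mu)) t).
  apply is_series_unique.
  pose proof (is_series_laplace mu t H) as H0.
  rewrite <- CV_radius_degree_weighted in H.
  pose proof (is_series_laplace _ t H) as H1.
  rewrite <- CV_radius_degree_weighted in H.
  pose proof (is_series_laplace _ t H) as H2.
  (* With [m = A1 / A0], the three factors are the coefficients 1, [- 2 m] and [m ^ 2] of the
     expanded square [(n - m) ^ 2], divided by the normalization [A0]. *)
  apply (is_series_scal_r (/ A0)) in H2.
  apply (is_series_scal_r (- 2 * (A1 / A0) / A0)) in H1.
  apply (is_series_scal_r ((A1 / A0) ^ 2 / A0)) in H0.
  pose proof (is_series_plus _ _ _ _ (is_series_plus _ _ _ _ H2 H1) H0) as Hs.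
  fold A0 A1 A2 in Hs.
  replace (A2 / A0 - (A1 / A0) ^ 2) with
    (plus (plus (A2 * / A0) (A1 * (-2 * (A1 / A0) / A0))) (A0 * ((A1 / A0) ^ 2 / A0))).
  2: { unfold plus; simpl. field. lra. }
  apply is_series_ext with (2 := Hs). intros n.
  unfold plus, member_mass, laplace_summand, degree_weighted; simpl. fold A0.
  field. lra.
Qed.

Lemma member_mass_0 (mu : nat -> R) (t : R) :
  member_mass mu t 0 = mu 0%nat / laplace mu t.
Proof.
  unfold member_mass. simpl INR. rewrite Rmult_0_l, exp_0. now rewrite Rmult_1_r.
Qed.

(** The lower bound is Markov's inequality: the mass outside 0 is at most the mean, since [1 <= n]
    there. The upper bound drops the nonnegative terms of index at least 1. *)
Lemma member_mass_0_bounds (mu : nat -> R) (t : R) :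
  generating_measure mu -> Rbar_lt (exp t) (CV_radius mu) ->
  1 - mean (member_mass mu t) <= member_mass mu t 0 <= 1.
Proof.
  intros Hg H. pose proof (laplace_pos mu t Hg H) as Hpos.
  destruct Hg as (Hmu & _ & _).
  rewrite mean_member_mass, member_mass_0.
  pose proof (ex_series_laplace_summand mu t H) as H0.
  rewrite <- CV_radius_degree_weighted in H.
  pose proof (ex_series_laplace_summand _ t H) as H1.
  assert (E0 : laplace mu t =
               mu 0%nat + Series (fun n => laplace_summand mu t (S n))).
  { unfold laplace. rewrite Series_incr_1 by exact H0. f_equal.
    unfold laplace_summand; simpl. rewrite Rmult_0_l, exp_0. ring. }
  assert (E1 : laplace (degree_weighted mu) t =
               Series (fun n => laplace_summand (degree_weighted mu) t (S n))).
  { unfold laplace. rewrite Series_incr_1 by exact H1.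
    unfold laplace_summand at 1, degree_weighted at 1; simpl. ring. }
  assert (Hn : forall n, 0 <= laplace_summand mu t (S n)).
  { intros n. apply Rmult_le_pos; [apply Hmu | apply Rlt_le, exp_pos]. }
  assert (L0 : 0 <= Series (fun n => laplace_summand mu t (S n))).
  (* Zero is written as 0 times the series, so that a termwise comparison applies. *)
  { rewrite <- (Rmult_0_l (Series (fun n => laplace_summand mu t (S n)))) at 1.
    rewrite <- Series_scal_l.
    apply Series_le.
    - intros n. specialize (Hn n). lra.
    - apply -> (ex_series_incr_1 (laplace_summand mu t)). exact H0. }
  assert (L1 : Series (fun n => laplace_summand mu t (S n)) <=
               Series (fun n => laplace_summand (degree_weighted mu) t (S n))).
  { apply Series_le.
    - intros n. split; [apply Hn|].
      replace (laplace_summand (degree_weighted mu) t (S n))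
        with (INR (S n) * laplace_summand mu t (S n))
        by (unfold laplace_summand, degree_weighted; ring).
      rewrite <- (Rmult_1_l (laplace_summand mu t (S n))) at 1.
      apply Rmult_le_compat_r; [apply Hn|].
      rewrite S_INR. pose proof (pos_INR n). lra.
    - apply -> (ex_series_incr_1 (laplace_summand (degree_weighted mu) t)). exact H1. }
  split.
  - apply Rmult_le_reg_r with (laplace mu t); [exact Hpos|].
    field_simplify; [|lra|lra]. lra.
  - apply Rmult_le_reg_r with (laplace mu t); [exact Hpos|].
    field_simplify; [|lra]. lra.
Qed.

(** The quotient rule gives [(L' / L)' = L'' / L - (L' / L) ^ 2], which is the variance. *)
Lemma is_derive_member_mean (mu : nat -> R) (t : R) :
  Rbar_lt (exp t) (CV_radius mu) -> 0 < laplace mu t ->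
  is_derive (fun s => mean (member_mass mu s)) t (variance (member_mass mu t)).
Proof.
  intros H Hpos.
  apply is_derive_ext with (fun s => laplace (degree_weighted mu) s / laplace mu s).
  { intros s. symmetry. apply mean_member_mass. }
  rewrite variance_member_mass by assumption.
  pose proof (is_derive_laplace mu t H) as D0.
  rewrite <- CV_radius_degree_weighted in H.
  pose proof (is_derive_laplace _ t H) as D1.
  pose proof (is_derive_div _ _ _ _ _ D1 D0 (Rgt_not_eq _ _ Hpos)) as D.
  refine (is_derive_eq _ _ _ _ D _).
  field. lra.
Qed.

Lemma is_derive_member_mass_0 (mu : nat -> R) (t : R) :
  Rbar_lt (exp t) (CV_radius mu) -> 0 < laplace mu t ->
  is_derive (fun s => member_mass mu s 0) t
    (- mean (member_mass mu t) * member_mass mu t 0).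
Proof.
  intros H Hpos.
  apply is_derive_ext with (fun s => mu 0%nat / laplace mu s).
  { intros s. symmetry. apply member_mass_0. }
  rewrite member_mass_0, mean_member_mass.
  pose proof (is_derive_laplace mu t H) as D0.
  pose proof (is_derive_div _ _ _ _ _ (is_derive_const (mu 0%nat) t) D0
                (Rgt_not_eq _ _ Hpos)) as D.
  refine (is_derive_eq _ _ _ _ D _).
  unfold zero; simpl. field. lra.
Qed.

(** * The zero mass as a function of the mean *)

Lemma abm_variance_pos (p : R) (r : nat) (x : R) :
  0 < p -> 0 < x -> 0 < abm_variance p r x.
Proof.
  intros hp hx. apply Rmult_lt_0_compat; [exact hx|]. apply pow_lt.
  pose proof (Rdiv_lt_0_compat x p hx hp). lra.
Qed.

Lemma filterlim_at_right_id (x : R) : filterlim (fun y : R => y) (at_right x) (locally x).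
Proof. intros Q HQ. unfold filtermap, at_right, within. now apply filter_imp with (2 := HQ). Qed.

(** The generating measure is not normalized: [K] below is unaffected by rescaling [mu], and its
    value is fixed by the limit at small means. Positivity of the zero mass comes out as a
    consequence. *)
Lemma abm_zero_mass (p : R) (r : nat) (F : (nat -> R) -> Prop) (phi : R -> R)
    (P : nat -> R) :
  0 < p -> is_abm_nef p r F -> is_abm_phi p r phi -> F P ->
  P 0%nat = exp (- phi (mean P)).
Proof.
  intros hp [(mu & Hg & HF) [HM HV]] [Hphi Hlim] HP.
  set (D t := canonical_domain mu t).
  assert (HFm : forall t, D t -> F (member_mass mu t)).
  { intros t Ht. apply HF. exists t. now split. }
  set (K t := member_mass mu t 0 * exp (phi (mean (member_mass mu t)))).
  assert (Kconst : forall a b, D a -> D b -> K a = K b).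
  { assert (Klt : forall a b, D a -> D b -> a < b -> K a = K b).
    { intros a b _ Hb Hab. apply eq_is_derive; [|exact Hab]. intros t [_ Htb].
      (* The support lies in the nonnegative integers, so the canonical domain is
         stable by decreasing the parameter. *)
      assert (Ht : D t).
      { destruct Hb as [d Hd]. exists d. intros s Hs.
        assert (Hs' : ex_series (laplace_summand mu (s + (b - t)))).
        { apply Hd. change (Rabs (s + (b - t) - b) < d).
          change (Rabs (s - t) < d) in Hs.
          now replace (s + (b - t) - b) with (s - t) by ring. }
        apply (ex_series_le (V := R_CompleteNormedModule)) with (2 := Hs'). intros n.
        change (Rabs (laplace_summand mu s n) <= laplace_summand mu (s + (b - t)) n).
        destruct Hg as (Hmu & _).
        rewrite Rabs_pos_eq.
        - apply Rmult_le_compat_l; [apply Hmu|].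
          assert (Hle : INR n * s <= INR n * (s + (b - t))).
          { apply Rmult_le_compat_l; [apply pos_INR | lra]. }
          destruct Hle as [Hlt | ->]; [apply Rlt_le, exp_increasing, Hlt | lra].
        - apply Rmult_le_pos; [apply Hmu | apply Rlt_le, exp_pos]. }
      pose proof (canonical_domain_CV_radius mu t Ht) as Hr.
      pose proof (laplace_pos mu t Hg Hr) as Hpos.
      assert (Hm : 0 < mean (member_mass mu t)).
      { apply HM. exists (member_mass mu t). split; [now apply HFm | reflexivity]. }
      pose proof (is_derive_member_mean mu t Hr Hpos) as Dm.
      rewrite (HV _ (HFm t Ht)) in Dm.
      pose proof (is_derive_member_mass_0 mu t Hr Hpos) as D0.
      pose proof (is_derive_comp _ _ _ _ _ (Hphi _ Hm) Dm) as Dp.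
      pose proof (is_derive_comp _ _ _ _ _ (is_derive_exp _) Dp) as De.
      pose proof (is_derive_mult _ _ _ _ _ D0 De Rmult_comm) as DK.
      (* The two terms cancel: [- m P_0 exp (phi m)] from the zero mass, and
         [P_0 exp (phi m) (m / V m) V m] from the chain rule. *)
      refine (is_derive_eq _ _ _ _ DK _).
      pose proof (abm_variance_pos p r _ hp Hm).
      unfold plus, mult, scal, zero; simpl; unfold mult; simpl.
      field. lra. }
    intros a b Ha Hb. destruct (Rtotal_order a b) as [h | [-> | h]].
    - now apply Klt.
    - reflexivity.
    - symmetry. now apply Klt. }
  apply HF in HP as (t & Ht & HPt).
  assert (Hexp : filterlim (fun e => exp (phi e)) (at_right 0) (locally 1)).
  { rewrite <- exp_0. apply filterlim_comp with (1 := Hlim).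
    apply continuous_exp. }
  (* Every small [e > 0] is the mean of some member, because the mean domain is the whole half-line.
     The constant [K t] can be evaluated at that member, where the bounds on the zero mass apply. *)
  assert (Hbound : at_right 0 (fun e => (1 - e) * exp (phi e) <= K t <= exp (phi e))).
  { exists (mkposreal 1 Rlt_0_1). intros e _ he.
    destruct (proj1 (HM e) he) as (Q & HQ & HQe).
    apply HF in HQ as (s & Hs & HQs).
    assert (Hms : mean (member_mass mu s) = e).
    { rewrite <- HQe. apply Series_ext. intros n. now rewrite HQs. }
    destruct (member_mass_0_bounds mu s Hg (canonical_domain_CV_radius mu s Hs))
      as [B1 B2].
    rewrite (Kconst t s Ht Hs). unfold K. rewrite Hms in *.
    pose proof (exp_pos (phi e)). split.
    - apply Rmult_le_compat_r; lra.
    - rewrite <- (Rmult_1_l (exp (phi e))) at 2. apply Rmult_le_compat_r; lra. }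
  assert (Hlow : filterlim (fun e => (1 - e) * exp (phi e)) (at_right 0) (locally 1)).
  { replace (locally 1) with (locally ((1 - 0) * 1)) by (f_equal; ring).
    refine (filterlim_comp_2 (fun e => 1 - e) (fun e => exp (phi e)) Rmult _ Hexp
              (filterlim_mult (K := R_AbsRing) (1 - 0) 1)).
    refine (filterlim_comp _ _ _ (fun e => e) (fun e => 1 - e) _ _ _
              (filterlim_at_right_id 0) _).
    apply (continuous_minus (fun _ => 1) (fun x => x));
      [apply continuous_const | apply continuous_id]. }
  assert (HK : K t = 1).
  { apply Rle_antisym.
    - apply (filterlim_le (F := at_right 0) (fun _ => K t) (fun e => exp (phi e)) (K t) 1).
      + now apply filter_imp with (2 := Hbound).
      + apply filterlim_const.
      + exact Hexp.
    - apply (filterlim_le (F := at_right 0) (fun e => (1 - e) * exp (phi e))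
               (fun _ => K t) 1 (K t)).
      + now apply filter_imp with (2 := Hbound).
      + exact Hlow.
      + apply filterlim_const. }
  assert (HmP : mean P = mean (member_mass mu t)).
  { apply Series_ext. intros n. now rewrite HPt. }
  rewrite HPt, HmP, exp_Ropp.
  unfold K in HK. pose proof (exp_pos (phi (mean (member_mass mu t)))).
  apply Rmult_eq_reg_r with (exp (phi (mean (member_mass mu t)))); [|lra].
  rewrite HK. field. lra.
Qed.

(** * Existence and comparison of the primitives *)

Lemma abm_phi_exists (p : R) (r : nat) : 0 < p -> exists phi, is_abm_phi p r phi.
Proof.
  intros hp.
  (* This is [x / V x] with the factor [x] cancelled. It is continuous on all of [(- p, +oo)], so
     its integral from 0 is differentiable at 0 too, which gives the limit at [0+]. *)
  set (f x := / (1 + x / p) ^ r).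
  assert (Hf : forall x, - p < x -> continuous f x).
  { intros x hx. apply (ex_derive_continuous f).
    assert (Hpos : 0 < 1 + x / p).
    { replace (1 + x / p) with ((x + p) / p) by (field; lra).
      apply Rdiv_lt_0_compat; lra. }
    pose proof (pow_lt _ r Hpos). unfold f. auto_derive. unfold Rdiv in *. lra. }
  assert (HD : forall x, - p < x -> is_derive (RInt f 0) x (f x)).
  { intros x hx. apply is_derive_RInt with 0; [|now apply Hf].
    assert (hd : 0 < x + p) by lra.
    (* The radius [x + p] keeps [y] above [- p], so the segment from 0 to [y] stays where [f] is
       continuous. *)
    exists (mkposreal _ hd). intros y Hy.
    change (Rabs (y - x) < x + p) in Hy. apply Rabs_lt_between in Hy.
    apply (RInt_correct f), (ex_RInt_continuous f). intros z [Hz _]. apply Hf.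
    unfold Rmin in Hz. destruct (Rle_dec 0 y); lra. }
  exists (RInt f 0). split.
  - intros x hx. refine (is_derive_eq _ _ _ _ (HD x _) _); [lra|].
    pose proof (abm_variance_pos p r x hp hx) as Hv.
    unfold f, abm_variance in *. set (q := (1 + x / p) ^ r) in *.
    assert (q <> 0) by (intros E; rewrite E in Hv; lra).
    field. split; [assumption | lra].
  - replace (locally 0) with (locally (RInt f 0 0)) by now rewrite RInt_point.
    refine (filterlim_comp _ _ _ (fun e => e) (RInt f 0) _ _ _
              (filterlim_at_right_id 0) _).
    apply (ex_derive_continuous (RInt f 0)). exists (f 0). apply HD. lra.
Qed.

(** The difference [phi - phi'] tends to 0 at [0+] and has positive derivative, because the extra
    factor [1 + x / p] exceeds 1. *)
Lemma abm_phi_succ_lt (p : R) (r : nat) (phi phi' : R -> R) (m : R) :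
  0 < p -> 0 < m -> is_abm_phi p r phi -> is_abm_phi p (S r) phi' ->
  phi' m < phi m.
Proof.
  intros hp hm [Hd Hl] [Hd' Hl'].
  set (d x := phi x - phi' x).
  set (df x := x / abm_variance p r x - x / abm_variance p (S r) x).
  assert (HD : forall x, 0 < x -> is_derive d x (df x)).
  { intros x hx. apply (is_derive_minus phi phi'); [now apply Hd | now apply Hd']. }
  assert (Hpos : forall x, 0 < x -> 0 < df x).
  { intros x hx. unfold df.
    pose proof (abm_variance_pos p r x hp hx) as Hv.
    pose proof (Rdiv_lt_0_compat x p hx hp) as Hxp.
    assert (Hlt : abm_variance p r x < abm_variance p (S r) x).
    { replace (abm_variance p (S r) x) with (abm_variance p r x * (1 + x / p))
        by (unfold abm_variance; simpl; ring).
      rewrite <- (Rmult_1_r (abm_variance p r x)) at 1.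
      apply Rmult_lt_compat_l; lra. }
    apply Rlt_0_minus, Rmult_lt_compat_l; [exact hx|].
    apply Rinv_lt_contravar; [|exact Hlt].
    apply Rmult_lt_0_compat; lra. }
  (* The mean value theorem is used only away from 0, where the value of [d] is unspecified. *)
  assert (Hinc : forall a b, 0 < a -> a < b -> d a < d b).
  { intros a b ha hab.
    destruct (MVT_gen d a b df) as (c & Hc & E).
    - intros x Hx. apply HD. rewrite Rmin_left in Hx; lra.
    - intros x Hx. apply continuity_pt_filterlim.
      apply (ex_derive_continuous d). exists (df x). apply HD.
      rewrite Rmin_left in Hx; lra.
    - rewrite Rmin_left in Hc by lra.
      assert (0 < df c * (b - a)).
      { apply Rmult_lt_0_compat; [apply Hpos|]; lra. }
      lra. }
  assert (Hlim : filterlim d (at_right 0) (locally 0)).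
  { replace (locally 0) with (locally (minus 0 0)) by (f_equal; exact (minus_eq_zero (G := R_AbelianGroup) 0)).
    refine (filterlim_comp_2 phi (fun x => opp (phi' x)) plus Hl _
              (filterlim_plus (V := R_NormedModule) 0 (opp 0))).
    exact (filterlim_comp _ _ _ phi' opp _ _ _ Hl' (filterlim_opp (V := R_NormedModule) 0)). }
  (* Passing to the limit only gives a weak inequality. It is taken at [m / 2], and strict growth
     from [m / 2] to [m] restores strictness. *)
  assert (Hhalf : 0 <= d (m / 2)).
  { apply (filterlim_le (F := at_right 0) d (fun _ => d (m / 2)) 0 (d (m / 2))).
    - assert (hm2 : 0 < m / 2) by lra.
      exists (mkposreal _ hm2). intros x Hx hx.
      change (Rabs (x - 0) < m / 2) in Hx.
      apply Rabs_lt_between in Hx. apply Rlt_le, Hinc; lra.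
    - exact Hlim.
    - apply filterlim_const. }
  pose proof (Hinc (m / 2) m ltac:(lra) ltac:(lra)). unfold d in *. lra.
Qed.

Theorem proposition7 (p m : R) (hp : 0 < p) (hm : 0 < m) (r : nat) :
  (forall F F' : (nat -> R) -> Prop,
     is_abm_nef p r F -> is_abm_nef p (S r) F' ->
     forall P P' : nat -> R,
       F P -> mean P = m -> F' P' -> mean P' = m -> P 0%nat < P' 0%nat) /\
  (forall phi phi' : R -> R,
     is_abm_phi p r phi -> is_abm_phi p (S r) phi' ->
     exp (- phi m) < exp (- phi' m)).
Proof.
  assert (Hphi : forall phi phi' : R -> R,
     is_abm_phi p r phi -> is_abm_phi p (S r) phi' ->
     exp (- phi m) < exp (- phi' m)).
  { intros phi phi' H H'. apply exp_increasing.
    pose proof (abm_phi_succ_lt p r phi phi' m hp hm H H'). lra. }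
  split; [|exact Hphi].
  intros F F' HF HF' P P' HP HmP HP' HmP'.
  (* The claim on families mentions no primitive; supplying one for each exponent reduces it to the
     claim on [exp (- phi m)]. *)
  destruct (abm_phi_exists p r hp) as [phi H].
  destruct (abm_phi_exists p (S r) hp) as [phi' H'].
  rewrite (abm_zero_mass p r F phi P hp HF H HP), HmP.
  rewrite (abm_zero_mass p (S r) F' phi' P' hp HF' H' HP'), HmP'.
  now apply Hphi.
Qed.
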